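(* Let $k\ge 3$, $n\ge1$, and let $[a_0,\dots,a_{k-1}]$ represent a $k$-gon modulo $n$, with monodromy group $G(a_0,\dots,a_{k-1})$. Let $C$ be the $k\times k$ integer circulant matrix whose $(i,j)$ entry is $a_{(i-j)\bmod k}$ ($0\le i,j\le k-1$), and let $d_1,\dots,d_k$ be the elementary divisors of the Smith Normal Form of $C$ viewed as a matrix over $\mathbb{Z}$. Then $$G(a_0,\dots,a_{k-1})\cong\Big(\bigoplus_{i=1}^k C_{\delta_i}\Big)\rtimes C_k,\qquad \delta_i=\frac{n}{\gcd(d_i,n)},$$ where $C_m$ denotes the cyclic group of order $m$.
   Context: A $k$-tuple of positive integers $[a_0,\dots,a_{k-1}]$ ($k\ge 3$) represents a $k$-gon modulo $n$ if $a_0+\dots+a_{k-1}=(k-2)n$, $a_i<2n$, $a_i\ne n$ for all $i$, and $\gcd(a_0,\dots,a_{k-1},n)=1$. Indices are read modulo $k$. Its monodromy group $G(a_0,\dots,a_{k-1})$ is the group of permutations of the set $\mathbb{Z}/n\mathbb{Z}\times\mathbb{Z}/k\mathbb{Z}$ generated by $\sigma_0(m,i)=(m,i+1)$ and $\sigma_1(m,i)=(m-a_{i-1},i-1)$ (the monodromy group of the dessin on the rational billiards surface of the polygon). The Smith Normal Form of an integer matrix $C$ is a factorization $C=UDV$ with $U,V$ integer matrices of determinant $\pm1$ and $D=\mathrm{diag}(d_1,\dots,d_k)$ with nonnegative $d_i$ and $d_i\mid d_{i+1}$; the $d_i$ are the elementary divisors. Convention: $\gcd(0,n)=n$. *)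

(* Defs.v *)
From mathcomp Require Import all_boot all_order all_algebra all_fingroup.

Set Implicit Arguments.
Unset Strict Implicit.
Unset Printing Implicit Defensive.

(* Indices are elements of 'I_k; [ordS] and [ord_pred] are the cyclic successor
   and predecessor, so they implement i + 1 and i - 1 modulo k. *)

Definition represents_polygon (n k : nat) (a : k.-tuple nat) : Prop :=
  [/\ forall i, 0 < tnth a i,
      \sum_(i < k) tnth a i = (k - 2) * n,
      forall i, tnth a i < 2 * n,
      forall i, tnth a i <> n
    & gcdn (\big[gcdn/0]_(i < k) tnth a i) n = 1].

Section Monodromy.

(* Z/nZ is represented by 'I_n, which has exactly n elements for every n
   (unlike 'Z_n, which is Z/2Z when n < 2). *)
Fact subZn_subproof n (m : 'I_n) (c : nat) : (m + (n - c %% n)) %% n < n.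
Proof. by rewrite ltn_pmod // (leq_ltn_trans _ (ltn_ord m)). Qed.

(* m - c in Z/nZ, for a natural number c *)
Definition subZn n (m : 'I_n) (c : nat) : 'I_n :=
  Ordinal (subZn_subproof m c).

Lemma subZn_inj n c : injective (fun m : 'I_n => subZn m c).
Proof.
move=> m1 m2 [] /eqP; rewrite eqn_modDr !modn_small //.
by move/eqP/val_inj.
Qed.

Variables (n k : nat) (a : k.-tuple nat).

Definition sigma0_fun (x : 'I_n * 'I_k) : 'I_n * 'I_k := (x.1, ordS x.2).

Definition sigma1_fun (x : 'I_n * 'I_k) : 'I_n * 'I_k :=
  (subZn x.1 (tnth a (ord_pred x.2)), ord_pred x.2).

Lemma sigma0_inj : injective sigma0_fun.
Proof.
move=> [m1 i1] [m2 i2] /eqP /=; rewrite xpair_eqE /= => /andP[/eqP-> /eqP ei].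
by rewrite (ordS_inj ei).
Qed.

Lemma sigma1_inj : injective sigma1_fun.
Proof.
move=> [m1 i1] [m2 i2] /eqP /=; rewrite xpair_eqE /= => /andP[/eqP em /eqP ei].
by move: em; rewrite (ord_pred_inj ei) => /subZn_inj ->.
Qed.

Definition sigma0 : {perm 'I_n * 'I_k} := perm sigma0_inj.
Definition sigma1 : {perm 'I_n * 'I_k} := perm sigma1_inj.

Definition monodromy_group : {group {perm 'I_n * 'I_k}} :=
  <<[set sigma0; sigma1]>>%G.

End Monodromy.

Section Circulant.

Import GRing.Theory.
Local Open Scope ring_scope.

Definition circulant (k : nat) (a : k.-tuple nat) : 'M[int]_k :=
  \matrix_(i < k, j < k) (nth 0%N a ((i + (k - j)) %% k))%:Z.

(* The d i are natural numbers, hence nonnegative; they may vanish, with the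
   convention that 0 divides only 0. *)
Definition elementary_divisors (k : nat) (C : 'M[int]_k) (d : 'I_k -> nat) :
    Prop :=
  (forall i j : 'I_k, j = i.+1 :> nat -> (d i %| d j)%N) /\
  exists U V : 'M[int]_k,
    [/\ \det U = 1 \/ \det U = -1,
        \det V = 1 \/ \det V = -1
      & C = U *m diag_mx (\row_(i < k) (d i)%:Z) *m V].

End Circulant.

(* [Zp m] is the cyclic group of order m for every m > 0 (trivial for m = 1),
   and [setXn] is the external direct product. *)
Definition prod_cyclic (k : nat) (delta : 'I_k -> nat) :
    {group {dffun forall i : 'I_k, 'Z_(delta i)}} :=
  setXn_group (fun i => Zp_group (delta i)).

(* G is isomorphic to an external semidirect product N ><| H, for some action
   of H on N by group automorphisms. *)
Definition isog_sdprod (gT nT hT : finGroupType)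
    (G : {group gT}) (N : {group nT}) (H : {group hT}) : Prop :=
  exists to : groupAction H N, G \isog [set: sdprod_by to].

(* Main.v *)
Require Import Defs.
From mathcomp Require Import all_boot all_order all_algebra all_fingroup.
From mathcomp Require Import zify.

(** The product sigma0 sigma1 translates the fibre over i by - a_i, and
    conjugation by sigma0 rotates translation vectors. So the monodromy group
    is N ><| <sigma0>, where N consists of the translations by the vectors C v,
    v in Z^k. Writing C = U D V with U and V unimodular, the translation by
    C v = U D (V v) only depends on the i-th entry of V v modulo
    n / gcd (d_i, n), and is trivial only if all these residues vanish. *)

Set Implicit Arguments.
Unset Strict Implicit.
Unset Printing Implicit Defensive.

(** * External form of an internal semidirect product *)

Section ExternalSdprod.

Local Open Scope group_scope.

Variables (gT nT hT : finGroupType).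
Variables (G : {group gT}) (N : {group nT}) (H : {group hT}).
Variables (f : {morphism N >-> gT}) (h : {morphism H >-> gT}).
Hypotheses (injf : 'injm f) (injh : 'injm h).
Hypothesis defG : f @* N ><| h @* H = G.

(* [is_action] demands injectivity of every a, even outside H, and
   [is_groupAction] demands fixing all x outside N. *)
Definition conj_act (x : nT) (a : hT) : nT :=
  if (x \in N) && (a \in H) then invm injf (f x ^ h a) else x.

Lemma conj_act_im x a :
  x \in N -> a \in H -> f x ^ h a \in f @* N.
Proof.
move=> Nx Ha; case/sdprodP: defG => _ _ nNH _.
by rewrite memJ_norm ?mem_morphim // (subsetP nNH) ?mem_morphim.
Qed.

Lemma conj_act_in x a : x \in N -> a \in H -> conj_act x a \in N.
Proof.
move=> Nx Ha; rewrite /conj_act Nx Ha /=.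
by case/morphimP: (conj_act_im Nx Ha) => y _ Ny ->; rewrite invmE.
Qed.

Lemma conj_actE x a :
  x \in N -> a \in H -> f (conj_act x a) = f x ^ h a.
Proof.
by move=> Nx Ha; rewrite /conj_act Nx Ha invmK // conj_act_im.
Qed.

Lemma conj_act_is_action : is_action H conj_act.
Proof.
split=> [a x y | x a b Ha Hb].
  have [Ha | nHa] := boolP (a \in H); last first.
    by rewrite /conj_act (negbTE nHa) !andbF.
  (* The map preserves [N] and fixes its complement pointwise, so the two mixed cases are
     contradictory. *)
  case: (boolP (x \in N)) (boolP (y \in N)) => [Nx | nNx] [Ny | nNy].
  - move/(congr1 f); rewrite !conj_actE // => /conjg_inj.
    exact: (injmP injf).
  - move=> eqxy; have := conj_act_in Nx Ha.
    by rewrite eqxy /conj_act (negbTE nNy) /= (negbTE nNy).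
  - move=> eqxy; have := conj_act_in Ny Ha.
    by rewrite -eqxy /conj_act (negbTE nNx) /= (negbTE nNx).
  by rewrite /conj_act (negbTE nNx) (negbTE nNy).
have [Nx | nNx] := boolP (x \in N); last first.
  by rewrite /conj_act (negbTE nNx) /= (negbTE nNx).
apply: (injmP injf); rewrite ?conj_act_in ?groupM //.
by rewrite !conj_actE ?conj_act_in ?groupM // morphM // conjgM.
Qed.

Definition conj_action : action H nT := Action conj_act_is_action.

Lemma conj_is_groupAction : is_groupAction N conj_action.
Proof.
move=> a Ha /=; rewrite inE; apply/andP; split.
  apply/subsetP=> x; rewrite inE actpermE /= /conj_act.
  by case: ifP => [/andP[] | _ /eqP].
apply/morphicP=> x y Nx Ny; rewrite !actpermE /=.
apply: (injmP injf); rewrite ?groupM ?conj_act_in ?groupM //.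
by rewrite morphM ?conj_act_in // !conj_actE ?groupM // morphM // conjMg.
Qed.

Definition conj_groupAction : groupAction H N :=
  GroupAction conj_is_groupAction.

Lemma conj_morph_act : {in N & H, morph_act conj_groupAction 'J f h}.
Proof. by move=> x a Nx Ha; apply: conj_actE. Qed.

(** The map sending a pair to the product of its images under [f] and [h] is a morphism. It is
    injective because the images meet trivially, and its image is their product [G]. *)
Lemma sdprod_isog_sdprod : isog_sdprod G N H.
Proof.
case/sdprodP: defG => _ defNH _ tiNH.
exists conj_groupAction; rewrite isog_sym; apply/isogP.
exists (xsdprod_morphism conj_morph_act).
  by rewrite injm_xsdprodm injf injh tiNH /=.
by rewrite im_xsdprodm.
Qed.

End ExternalSdprod.

Import GRing.Theory.

(** * Translations of the fibres by integer vectors *)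

Section Translation.

Local Open Scope ring_scope.

Variables (n k : nat).
Implicit Types (m : 'I_n) (v w : 'cV[int]_k).

Fact addZn_subproof m (c : int) : (`|(m%:Z + c) %% n|%Z < n)%N.
Proof. by have := ltn_ord m; lia. Qed.

Definition addZn m (c : int) : 'I_n := Ordinal (addZn_subproof m c).

Lemma addZnE m c : (addZn m c)%:Z = ((m%:Z + c) %% n)%Z.
Proof. by have := ltn_ord m; rewrite /=; lia. Qed.

Lemma ordZ_inj m m' : m%:Z = m'%:Z -> m = m'.
Proof. by move=> [eqm]; apply: val_inj. Qed.

Lemma addZnD m c c' : addZn (addZn m c) c' = addZn m (c + c').
Proof. by apply: ordZ_inj; rewrite !addZnE modzDml addrA. Qed.

Lemma addZn_mod m c c' : (c = c' %[mod n])%Z -> addZn m c = addZn m c'.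
Proof.
by move=> eqc; apply: ordZ_inj; rewrite !addZnE -modzDmr eqc modzDmr.
Qed.

Lemma addZn0 m : addZn m 0 = m.
Proof.
by apply: ordZ_inj; rewrite addZnE addr0 modz_nat modn_small.
Qed.

Lemma addZnN m c : addZn m (- c%:Z) = subZn m c.
Proof.
apply: ordZ_inj; rewrite addZnE /= -modz_nat PoszD.
have c_lt : (c %% n < n)%N by rewrite ltn_pmod // (leq_ltn_trans _ (ltn_ord m)).
(* The summand [n] drops out modulo [n], leaving the negatives of [c] and [c %% n] to compare. *)
rewrite -subzn 1?ltnW // addrCA modzDl -[RHS]modzDmr -[LHS]modzDmr.
rewrite -modz_nat; congr (((_ + _) %% _)%Z).
by apply/eqP; rewrite eqz_mod_dvd opprK addrC -eqz_mod_dvd modz_mod.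
Qed.

Definition transl_fun w (x : 'I_n * 'I_k) : 'I_n * 'I_k :=
  (addZn x.1 (w x.2 0), x.2).

Lemma transl_inj w : injective (transl_fun w).
Proof.
move=> [m i] [m' i'] /eqP; rewrite xpair_eqE => /andP[/= /eqP + /eqP eqi].
rewrite eqi => /(congr1 (fun y => addZn y (- w i' 0))).
by rewrite !addZnD subrr !addZn0 => ->.
Qed.

Definition transl w : {perm 'I_n * 'I_k} := perm (@transl_inj w).

Lemma translE w m i : transl w (m, i) = (addZn m (w i 0), i).
Proof. by rewrite permE. Qed.

Lemma translD v w : transl (v + w) = (transl v * transl w)%g.
Proof.
by apply/permP=> -[m i]; rewrite permM !translE addZnD mxE.
Qed.

Lemma transl0 : transl 0 = 1%g.
Proof. by apply/permP=> -[m i]; rewrite perm1 translE mxE addZn0. Qed.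

Lemma translN w : transl (- w) = (transl w)^-1%g.
Proof.
by apply/eqP; rewrite eq_sym eq_invg_mul -translD addrN transl0.
Qed.

Lemma eq_transl v w :
  (forall i, (v i 0%R = w i 0%R %[mod n])%Z) -> transl v = transl w.
Proof.
by move=> eqvw; apply/permP=> -[m i]; rewrite !translE (addZn_mod _ (eqvw i)).
Qed.

Lemma transl_eq1 w : (0 < n)%N -> transl w = 1%g -> forall i, (n %| w i 0%R)%Z.
Proof.
move=> n_gt0 w1 i; have := congr1 (fun s : {perm _} => s (Ordinal n_gt0, i)) w1.
rewrite perm1 translE => /(congr1 (fun x : 'I_n * 'I_k => (x.1)%:Z)).
by rewrite addZnE add0r => /dvdz_mod0P.
Qed.

(** The vector [M *m v] is an integer combination of the columns of [M], and [transl] turns sums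
    into products. *)
Lemma transl_group_span (G : {group {perm 'I_n * 'I_k}}) (M : 'M[int]_k) v :
  (forall j, transl (col j M) \in G) -> transl (M *m v) \in G.
Proof.
move=> Gcol; have -> : M *m v = \sum_j v j 0 *: col j M.
  apply/matrixP=> i j; rewrite (ord1 j) mxE summxE.
  by apply: eq_bigr => l _; rewrite !mxE mulrC.
elim/big_ind: _ => [|u w Gu Gw|j _]; first by rewrite transl0 group1.
  by rewrite translD groupM.
have Gnat c : transl (c%:Z *: col j M) \in G.
  elim: c => [|c IHc]; first by rewrite scale0r transl0 group1.
  by rewrite -[c.+1]addn1 PoszD scalerDl scale1r translD groupM.
case: (v j 0) => c //.
by rewrite NegzE scaleNr translN groupV.
Qed.

End Translation.

(** * Conjugation by [sigma0] and circulant matrices *)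

Section Rotation.

Local Open Scope ring_scope.

Variables (n k : nat) (a : k.-tuple nat).
Local Notation s0 := (sigma0 n k).
Local Notation C := (circulant a).

Definition rotate (w : 'cV[int]_k) : 'cV[int]_k := \col_i w (ord_pred i) 0.

Lemma transl_conj_sigma0 w : (transl n w ^ s0 = transl n (rotate w))%g.
Proof.
apply/permP=> -[m i].
have -> : (m, i) = s0 (m, ord_pred i) by rewrite permE /sigma0_fun /= ord_predK.
by rewrite permJ !permE /sigma0_fun /transl_fun /= mxE ordSK.
Qed.

(** Entries depend only on i - j modulo k. If exactly one index wraps around, the numerators differ
    by k, whence the cases with [modnDl] and [modnDr]. *)
Lemma circulant_ordS i j : C (ordS i) (ordS j) = C i j.
Proof.
rewrite !mxE; congr (nth _ _ _)%:Z.
have [lti ltj] := (ltn_ord i, ltn_ord j).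
have -> : (ordS i : nat) = (if i.+1 == k then 0 else i.+1)%N.
  by rewrite /=; case: eqP => [->|?]; rewrite ?modnn // modn_small //; lia.
have -> : (ordS j : nat) = (if j.+1 == k then 0 else j.+1)%N.
  by rewrite /=; case: eqP => [->|?]; rewrite ?modnn // modn_small //; lia.
case: eqP => ?; case: eqP => ?.
- by congr (_ %% _)%N; lia.
- by rewrite -[LHS]modnDl; congr (_ %% _)%N; lia.
- by rewrite -[RHS]modnDr; congr (_ %% _)%N; lia.
by congr (_ %% _)%N; lia.
Qed.

(** Circulants commute with the cyclic shift; hence conjugation by [sigma0] preserves the
    translations by vectors [C *m v]. *)
Lemma rotate_circulant v : rotate (C *m v) = C *m rotate v.
Proof.
apply/colP=> i; rewrite !mxE [RHS](reindex_inj (@ordS_inj k)) /=.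
apply: eq_bigr => j _.
by rewrite -[C (ord_pred i) j]circulant_ordS ord_predK [rotate v _ _]mxE ordSK.
Qed.

Lemma col_circulant_ordS j : rotate (col j C) = col (ordS j) C.
Proof.
by apply/colP=> i; rewrite mxE [LHS]mxE [RHS]mxE -circulant_ordS ord_predK.
Qed.

Lemma sigma0_exp j m i : (s0 ^+ j)%g (m, i) = (m, iter j (@ordS k) i).
Proof.
by elim: j => [|j IHj]; rewrite ?perm1 // expgSr permM IHj permE.
Qed.

Lemma iter_ordS j i : iter j (@ordS k) i = ((i + j) %% k)%N :> nat.
Proof.
elim: j => [|j IHj] /=; first by rewrite addn0 modn_small.
by rewrite IHj -addn1 modnDml addn1 addnS.
Qed.

Lemma sigma0_expk : (s0 ^+ k = 1)%g.
Proof.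
apply/permP=> -[m i]; rewrite sigma0_exp perm1; congr pair.
by apply: val_inj; rewrite /= iter_ordS modnDr modn_small.
Qed.

(** The left factor acts first: [sigma0] moves i to i + 1, then [sigma1] returns to i and subtracts
    a_i. Column 0 of [C] lists the a_i. *)
Lemma mul_sigma0_sigma1 (i0 : 'I_k) :
  i0 = 0%N :> nat -> (s0 * sigma1 n a = transl n (- col i0 C))%g.
Proof.
move=> i00; apply/permP=> -[m i]; rewrite permM translE !permE /=.
rewrite /sigma1_fun /sigma0_fun /= ordSK; congr pair.
rewrite -addZnN !mxE i00 subn0 modnDr modn_small //.
by rewrite (tnth_nth 0%N).
Qed.

End Rotation.

(** After division by the gcd, the cofactors of n and d are coprime. This is where the orders n /
    gcd(d_i, n) come from. *)
Lemma dvdn_mul_gcd n d x :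
  (0 < n)%N -> (n %| d * x)%N = (n %/ gcdn d n %| x)%N.
Proof.
move=> n_gt0; have g_gt0 : (0 < gcdn d n)%N by rewrite gcdn_gt0 n_gt0 orbT.
have [/divnK ed /divnK en] := (dvdn_gcdl d n, dvdn_gcdr d n).
have co : coprime (n %/ gcdn d n) (d %/ gcdn d n).
  by rewrite /coprime -(eqn_pmul2r g_gt0) muln_gcdl en ed mul1n gcdnC.
by rewrite -(Gauss_dvdr x co) -[RHS](dvdn_pmul2r g_gt0) en mulnAC ed.
Qed.

(** * Integer residues as elements of a cyclic group *)

Section CyclicGroup.

Local Open Scope ring_scope.

Variable p : nat.
Hypothesis p_gt0 : (0 < p)%N.
Implicit Types x y : 'Z_p.

(** Membership matters for p = 1: the type ['Z_1] has two elements, while [Zp 1] is trivial. *)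
Lemma ltn_Zp x : x \in Zp p -> (x < p)%N.
Proof.
rewrite /Zp; case: ifP => [p_gt1 _ | _ /set1P-> //].
by have := ltn_ord x; rewrite [X in (_ < X)%N -> _]Zp_cast.
Qed.

Lemma Zp_mulg_mod x y :
  x \in Zp p -> y \in Zp p -> ((x * y)%g = x + y %[mod p])%N.
Proof.
rewrite /Zp; case: ifP => [p_gt1 _ _ | _ /set1P-> /set1P->].
  by rewrite -[RHS]modn_mod; congr (modn (modn _ _) p); apply: Zp_cast.
by rewrite mulg1.
Qed.

Definition Zp_of_int (c : int) : 'Z_p := inord `|(c %% p)%Z|%N.

Lemma Zp_of_int_val c : (Zp_of_int c)%:Z = (c %% p)%Z.
Proof.
rewrite inordK; first by lia.
by rewrite (leq_trans (_ : _ < p)%N) //; [lia | rewrite /Zp_trunc; lia].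
Qed.

Lemma Zp_of_int_in c : Zp_of_int c \in Zp p.
Proof.
rewrite /Zp; case: ifP => [|p_le1]; first by rewrite inE.
apply/set1P/ordZ_inj; rewrite Zp_of_int_val.
have -> : p = 1%N by lia.
by rewrite modz1.
Qed.

End CyclicGroup.

(** * Semidirect decomposition of the monodromy group *)

Section Monodromy.

Local Open Scope ring_scope.

Local Open Scope group_scope.

Variables (n k : nat) (a : k.-tuple nat) (d : 'I_k -> nat).
Variables U V : 'M[int]_k.
Hypotheses (n_gt0 : (0 < n)%N) (k_gt1 : (1 < k)%N).
Hypotheses (unitU : U \in unitmx) (unitV : V \in unitmx).

Local Notation C := (circulant a).
Local Notation D := (diag_mx (\row_(i < k) (d i)%:Z)).
Hypothesis defC : C = (U *m D *m V)%R.

Local Notation s0 := (sigma0 n k).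
Local Notation G := (monodromy_group n a).
Let delta i := (n %/ gcdn (d i) n)%N.
Local Notation P := (prod_cyclic delta).
Local Notation T := (transl n).

Let delta_gt0 i : (0 < delta i)%N.
Proof.
by rewrite divn_gt0 ?gcdn_gt0 ?n_gt0 ?orbT // dvdn_leq ?dvdn_gcdr.
Qed.

Lemma prod_cyclicP (x : {dffun forall i, 'Z_(delta i)}) :
  reflect (forall i, x i \in Zp (delta i)) (x \in P).
Proof. exact: setXnP. Qed.

(** If delta_i divides the i-th entry of v - w, then n divides d_i times that entry; applying [U]
    keeps all entries divisible by n. *)
Lemma transl_UD_mod (v w : 'cV[int]_k) :
  (forall i, (v i 0%R = w i 0%R %[mod delta i])%Z) ->
  T (U *m D *m v) = T (U *m D *m w).
Proof.
move=> eqvw; apply: eq_transl => i; apply/eqP; rewrite eqz_mod_dvd.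
suff : (n %| ((U *m (D *m (v - w))) i 0)%R)%Z.
  by rewrite mulmxA mulmxBr !mxE.
rewrite mxE; apply: rpred_sum => j _; apply: dvdz_mull.
rewrite mul_diag_mx !mxE dvdzE abszM dvdn_mul_gcd //.
by move/eqP: (eqvw j); rewrite eqz_mod_dvd.
Qed.

Definition prod_col (x : {dffun forall i, 'Z_(delta i)}) : 'cV[int]_k :=
  \col_i (x i)%:Z.

(** The factor [V] is left out because it permutes Z^k: the vectors [U *m D *m w] are exactly the
    vectors [C *m v]. *)
Definition prod_transl (x : {dffun forall i, 'Z_(delta i)}) :=
  T (U *m D *m prod_col x).

Lemma prod_translM : {in P &, {morph prod_transl : x y / x * y}}.
Proof.
move=> x y /prod_cyclicP Px /prod_cyclicP Py.
rewrite -translD -mulmxDr; apply: transl_UD_mod => i.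
rewrite !mxE mulg_ffun -PoszD !modz_nat; congr Posz.
exact: Zp_mulg_mod.
Qed.

Canonical prod_transl_morphism := Morphism prod_translM.

Lemma injm_prod_transl : 'injm prod_transl.
Proof.
apply/subsetP=> x /morphpreP[/prod_cyclicP Px /set1P x1].
apply/set1P/ffunP=> i; rewrite ffunE; apply: val_inj => /=.
have := transl_eq1 n_gt0 x1; rewrite -mulmxA => dvU.
(* The integer inverse of [U] shows that n divides each d_i x_i, so delta_i divides x_i, which is
   below delta_i. *)
have : (n %| ((invmx U *m (U *m (D *m prod_col x))) i 0)%R)%Z.
  by rewrite mxE; apply: rpred_sum => j _; apply: dvdz_mull.
rewrite mulKmx // mul_diag_mx !mxE dvdzE abszM dvdn_mul_gcd //.
by move/eqP; rewrite modn_small ?ltn_Zp.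
Qed.

Lemma im_prod_translP s :
  reflect (exists v, s = T (C *m v)) (s \in prod_transl @* P).
Proof.
apply: (iffP morphimP) => [[x _ _ ->] | [v ->]].
  by exists (invmx V *m prod_col x)%R; rewrite defC -mulmxA mulKVmx.
(* The preimage consists of the residues of [V *m v] modulo the delta_i. *)
pose x := [ffun i => Zp_of_int (delta i) ((V *m v)%R i 0%R)]
  : {dffun forall i, 'Z_(delta i)}.
have Px : x \in P.
  by apply/prod_cyclicP=> i; rewrite ffunE Zp_of_int_in.
exists x => //; rewrite defC -mulmxA; apply: transl_UD_mod => i.
by rewrite [prod_col x i 0]mxE ffunE Zp_of_int_val // modz_mod.
Qed.

Definition sigma0_pow (z : 'Z_k) := s0 ^+ z.

Lemma sigma0_powM : {in Zp k &, {morph sigma0_pow : x y / x * y}}.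
Proof.
move=> x y Zx Zy; have s0k := sigma0_expk n k.
rewrite /sigma0_pow -expgD -[LHS](expg_mod _ s0k).
by rewrite Zp_mulg_mod ?expg_mod // ltnW.
Qed.

Canonical sigma0_pow_morphism := Morphism sigma0_powM.

Let k_gt0 : (0 < k)%N := ltnW k_gt1.
Let i0 := Ordinal k_gt0.

Lemma im_sigma0_pow : sigma0_pow @* Zp k = <[s0]>.
Proof.
apply/eqP; rewrite eqEsubset; apply/andP; split.
  by apply/subsetP=> _ /morphimP[z _ _ ->]; rewrite mem_cycle.
rewrite cycle_subG; apply/morphimP; exists (Zp_of_int k 1).
- exact: Zp_of_int_in.
- exact: Zp_of_int_in.
rewrite /= /sigma0_pow.
(* The residue of 1 modulo k is 1 itself because k > 1. *)
by have := Zp_of_int_val k_gt0 1; rewrite modz_small ?lez_nat // => -[->].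
Qed.

(** A translation fixes the second coordinate, whereas [sigma0_pow z] sends (0, 0) to (0, z). This
    gives both injectivity and trivial intersection. *)
Lemma sigma0_pow_eq_transl z w : z \in Zp k -> sigma0_pow z = T w -> z = 1.
Proof.
move=> Zz; move/(congr1 (fun s : {perm _} => (s (Ordinal n_gt0, i0)).2 : nat)).
rewrite sigma0_exp translE /= iter_ordS add0n modn_small ?ltn_Zp // => z0.
exact: val_inj.
Qed.

Lemma injm_sigma0_pow : 'injm sigma0_pow.
Proof.
apply/subsetP=> z /morphpreP[Zz /set1P z1]; apply/set1P.
by apply: (sigma0_pow_eq_transl (w := 0%R)) => //; rewrite transl0.
Qed.

(** Column 0 comes from [sigma0 * sigma1], the other columns from it by conjugation with [sigma0],
    and all combinations follow. *)
Lemma transl_monodromy v : T (C *m v) \in G.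
Proof.
have Gs0 : s0 \in G by rewrite mem_gen ?set21.
have Gs1 : sigma1 n a \in G by rewrite mem_gen ?set22.
have G0 : T (col i0 C) \in G.
  by rewrite -groupV -translN -(mul_sigma0_sigma1 n a (i0 := i0)) ?groupM.
apply: transl_group_span => j.
have -> : j = iter j (@ordS k) i0.
  by apply: val_inj; rewrite /= iter_ordS add0n modn_small.
elim: {j}(j : nat) => //= j IHj.
by rewrite -col_circulant_ordS -transl_conj_sigma0 groupJ.
Qed.

Lemma monodromy_sdprod : prod_transl @* P ><| sigma0_pow @* Zp k = G.
Proof.
have nPs0 : sigma0_pow @* Zp k \subset 'N(prod_transl @* P).
  rewrite im_sigma0_pow cycle_subG; apply/normP/eqP.
  (* Conjugates have equal cardinality, so one inclusion suffices. *)
  rewrite eqEcard cardJg leqnn andbT.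
  apply/subsetP=> _ /imsetP[_ /im_prod_translP[v ->] ->].
  apply/im_prod_translP; exists (rotate v).
  by rewrite transl_conj_sigma0 rotate_circulant.
rewrite sdprodEY //; last first.
  apply/trivgP/subsetP=> s /setIP[/im_prod_translP[v ->]].
  case/morphimP=> z _ Zz Tz.
  by rewrite Tz (sigma0_pow_eq_transl Zz (esym Tz)) morph1 set11.
rewrite /= im_sigma0_pow; apply/eqP; rewrite eqEsubset join_subG
  cycle_subG gen_subG subUset !sub1set.
rewrite mem_gen ?set21 // andbT; apply/andP; split.
  by apply/subsetP=> _ /im_prod_translP[v ->]; apply: transl_monodromy.
have Js0 : s0 \in prod_transl @* P <*> <[s0]>.
  by rewrite mem_gen // inE cycle_id orbT.
(* Since [s0] is in the join, [sigma1] may be replaced by [s0 * sigma1], the translation by [C]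
   applied to minus the first basis vector. *)
rewrite Js0 /= -(groupMl _ Js0) (mul_sigma0_sigma1 n a (i0 := i0)) //.
rewrite mem_gen // inE; apply/orP; left; apply/im_prod_translP.
by exists (- delta_mx i0 0)%R; rewrite mulmxN colE.
Qed.

Lemma monodromy_isog_sdprod : isog_sdprod G P (Zp_group k).
Proof.
exact: (sdprod_isog_sdprod injm_prod_transl injm_sigma0_pow monodromy_sdprod).
Qed.

End Monodromy.

Theorem theorem2 (k n : nat) (a : k.-tuple nat) (d : 'I_k -> nat) :
  3 <= k -> 1 <= n ->
  represents_polygon n a ->
  elementary_divisors (circulant a) d ->
  isog_sdprod (monodromy_group n a)
    (prod_cyclic (fun i : 'I_k => n %/ gcdn (d i) n)) (Zp_group k).
Proof.
move=> k_ge3 n_gt0 _ [_ [U [V [detU detV defC]]]].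
have unit1 (M : 'M[int]_k) : (\det M = 1 \/ \det M = -1)%R -> M \in unitmx.
  by rewrite unitmxE => -[] ->.
exact: (monodromy_isog_sdprod n_gt0 (ltnW k_ge3) (unit1 U detU) (unit1 V detV)).
Qed.
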